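(* Let $Y$ be a Banach space over $\mathbb{K}$ with the BPB property. Then $Y$ has the FR-property.
   Context: $\mathbb{K}$ is $\mathbb{R}$ or $\mathbb{C}$. For a Banach space $Y$, $S_Y$ is its unit sphere and $Y^*$ its dual; for $u\in S_Y$, $D(Y,u)=\{y^*\in Y^* : \|y^*\|=y^*(u)=1\}$. Let $X$ be a closed subspace of $Y$ with inclusion $J:X\to Y$ (a linear isometry). Put $\Pi(X,Y)=\{(x,y^* )\in S_X\times S_{Y^*} : y^*\in D(Y,Jx)\}$. Let $B(S_X,Y)$ be the Banach space of all bounded functions from $S_X$ to $Y$ with the supremum norm. For $f\in B(S_X,Y)$, the spatial numerical range is $W(f)=\{y^*(f(x)) : (x,y^* )\in\Pi(X,Y)\}$ and the intrinsic numerical range is $V(f)=\{\Phi(f) : \Phi\in D(B(S_X,Y),J|_{S_X})\}$. A bounded linear operator $T:X\to Y$ is identified with $T|_{S_X}\in B(S_X,Y)$; $L(X,Y)$ is the space of bounded linear operators from $X$ to $Y$; $\overline{\mathrm{co}}$ denotes closed convex hull. A Banach space $Y$ has the FR-property if for every closed subspace $X$ of $Y$ and every $T\in L(X,Y)$, the equality $\overline{\mathrm{co}}\,W(T)=V(T)$ holds. The pair $(X,Y)$ is a BPB-pair if for every $\varepsilon>0$ there exists $\delta>0$ such that whenever $x_0\in S_X$, $y_0^*\in S_{Y^*}$ satisfy $\mathrm{Re}\,y_0^*(x_0)>1-\delta$, there exists $(x,y^* )\in\Pi(X,Y)$ with $\|x_0-x\|<\varepsilon$ and $\|y_0^*-y^*\|<\varepsilon$.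 A Banach space $Y$ has the BPB property if $(X,Y)$ is a BPB-pair for every closed subspace $X$ of $Y$. *)

(* Defs.v *)
From HB Require Import structures.
From mathcomp Require Import all_boot all_order all_algebra complex.
From mathcomp Require Import all_classical all_reals all_analysis.

Set Implicit Arguments.
Unset Strict Implicit.
Unset Printing Implicit Defensive.

Import Order.TTheory GRing.Theory Num.Theory.
Import numFieldNormedType.Exports.

Local Open Scope classical_set_scope.
Local Open Scope ring_scope.

Variant scalars := RealScalars | ComplexScalars.

Definition scalar_field (R : realType) (k : scalars) : numFieldType :=
  match k with
  | RealScalars => R : numFieldType
  | ComplexScalars => R[i]%C : numFieldType
  end.

Section Scalars.
Context {R : realType} {k : scalars}.
Local Notation K := (scalar_field R k).

Definition re_part : K -> R :=
  match k return scalar_field R k -> R with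
  | RealScalars => fun x => x
  | ComplexScalars => fun z => complex.Re z
  end.

Definition of_real : R -> K :=
  match k return R -> scalar_field R k with
  | RealScalars => fun x => x
  | ComplexScalars => fun x => (x%:C)%C
  end.

Lemma reD x y : re_part (x + y) = re_part x + re_part y.
Proof.
rewrite /re_part; move: x y; case: k => //= -[a b] [c d]; exact: erefl.
Qed.

Lemma re_le x y : x <= y -> re_part x <= re_part y.
Proof.
rewrite /re_part; move: x y; case: k => //= x y.
by rewrite lecE => /andP[].
Qed.

Lemma re0 : re_part 0 = 0.
Proof. by rewrite /re_part; case: k. Qed.

Lemma reK x : 0 <= x -> of_real (re_part x) = x.
Proof.
rewrite /re_part /of_real; move: x; case: k => //= -[a b].
by rewrite lecE /= => /andP[/eqP -> _].
Qed.

Lemma of_realD x y : of_real (x + y) = of_real x + of_real y.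
Proof. by rewrite /of_real; case: k => //; exact: rmorphD. Qed.

Lemma of_realM x y : of_real (x * y) = of_real x * of_real y.
Proof. by rewrite /of_real; case: k => //; exact: rmorphM. Qed.

Lemma of_real_le x y : x <= y -> of_real x <= of_real y.
Proof. by rewrite /of_real; case: k => //= xy; rewrite lecE /= eqxx. Qed.

Lemma of_real_eq0 x : of_real x = 0 -> x = 0.
Proof. by rewrite /of_real; case: k => //= -[]. Qed.

Lemma re_ge0M x y : 0 <= x -> 0 <= y -> re_part (x * y) = re_part x * re_part y.
Proof.
move=> /reK <- /reK <-; rewrite -of_realM.
suff reK' (r : R) : re_part (of_real r) = r by rewrite !reK'.
by rewrite /re_part /of_real; case: k.
Qed.

(* Norms of K-normed modules take values in K; this is the norm as a real. *)
Definition rnorm {V : normedModType K} (v : V) : R := re_part `|v|.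

Lemma rnorm_ge0 (V : normedModType K) (v : V) : 0 <= rnorm v.
Proof. by rewrite -re0 re_le. Qed.

End Scalars.

Section BoundedFunctions.
Context {R : realType} {k : scalars}.
Local Notation K := (scalar_field R k).

Definition bounded_fun_pred (T : Type) (Y : normedModType K) : {pred T -> Y} :=
  fun f => `[< bounded_fun f >].

Record bfun (T : Type) (Y : normedModType K) := BFun {
  bfun_val :> T -> Y;
  bfun_valP : bfun_val \in @bounded_fun_pred T Y }.

Section Theory.
Context (T : Type) (Y : normedModType K).

Lemma bounded_funE (f : T -> Y) :
  (f \in @bounded_fun_pred T Y) <-> exists M : K, forall t, `|f t| <= M.
Proof.
split=> [/asboolP/pinfty_ex_gt0[M _ fM]|[M fM]].
  by exists M => t; exact: fM.
apply/asboolP; have [[t _]|T0] := pselect (exists t : T, True).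
  have PF : ProperFilter (globally [set: T]).
    exact: (@globally_properfilter _ _ t).
  by apply/(ex_bound f); exists M => t' _; exact: fM.
exists 0; split=> // N _ t _; exfalso; apply: T0; by exists t.
Qed.

Lemma bounded_fun_submod : GRing.submod_closed (@bounded_fun_pred T Y).
Proof.
split=> [|a f g /bounded_funE[M fM] /bounded_funE[N gN]]; apply/bounded_funE.
  by exists 0 => t; rewrite normr0.
exists (`|a| * M + N) => t; rewrite (le_trans (ler_normD _ _))// lerD//.
by rewrite normrZ ler_wpM2l.
Qed.

HB.instance Definition _ :=
  GRing.isSubmodClosed.Build K (T -> Y) (@bounded_fun_pred T Y)
    bounded_fun_submod.

HB.instance Definition _ := [isSub for @bfun_val T Y].
HB.instance Definition _ := [Choice of bfun T Y by <:].
HB.instance Definition _ := [SubChoice_isSubLmodule of bfun T Y by <:].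

Definition sup_norm (f : bfun T Y) : R := sup (range (fun t => rnorm (f t))).

Lemma has_ubound_bfun (f : bfun T Y) :
  has_ubound (range (fun t => rnorm (f t))).
Proof.
have /bounded_funE[M fM] := bfun_valP f.
by exists (re_part M) => _ [t _ <-]; exact/re_le/fM.
Qed.

Lemma sup_norm_ub (f : bfun T Y) t : rnorm (f t) <= sup_norm f.
Proof. by apply: (ub_le_sup (has_ubound_bfun f)); exists t. Qed.

Lemma sup_norm_le (f : bfun T Y) (M : R) :
  0 <= M -> (forall t, rnorm (f t) <= M) -> sup_norm f <= M.
Proof.
move=> M0 fM; have [e|/set0P ne] := eqVneq (range (fun t => rnorm (f t))) set0.
  by rewrite /sup_norm e sup0.
by apply: ge_sup => // _ [t _ <-]; exact: fM.
Qed.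

Lemma sup_norm_ge0 (f : bfun T Y) : 0 <= sup_norm f.
Proof.
have [e|/set0P[_ [t _ _]]] := eqVneq (range (fun t => rnorm (f t))) set0.
  by rewrite /sup_norm e sup0.
exact: le_trans (rnorm_ge0 _) (sup_norm_ub f t).
Qed.

Lemma sup_normD f g : sup_norm (f + g) <= sup_norm f + sup_norm g.
Proof.
apply: sup_norm_le => [|t]; first by rewrite addr_ge0 ?sup_norm_ge0.
rewrite (le_trans _ (lerD (sup_norm_ub f t) (sup_norm_ub g t)))//.
by rewrite /rnorm -reD re_le// ler_normD.
Qed.

Lemma rnormZ (a : K) (y : Y) : rnorm (a *: y) = re_part `|a| * rnorm y.
Proof. by rewrite /rnorm normrZ re_ge0M. Qed.

Let sup_normZ_le (a : K) f : sup_norm (a *: f) <= re_part `|a| * sup_norm f.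
Proof.
have a0 : 0 <= re_part `|a| by rewrite -(@re0 R k) re_le.
apply: sup_norm_le => [|t]; first by rewrite mulr_ge0 ?sup_norm_ge0.
by rewrite [_ t]/(a *: f t) rnormZ ler_wpM2l// sup_norm_ub.
Qed.

Lemma sup_normZ (a : K) f : sup_norm (a *: f) = re_part `|a| * sup_norm f.
Proof.
apply/eqP; rewrite eq_le sup_normZ_le /=.
have [->|a0] := eqVneq a 0; first by rewrite normr0 re0 mul0r sup_norm_ge0.
have := sup_normZ_le a^-1 (a *: f).
rewrite scalerA mulVf// scale1r => /(ler_wpM2l (_ : 0 <= re_part `|a|)) H.
rewrite (le_trans (H _))//; first by rewrite -(@re0 R k) re_le.
rewrite mulrA -re_ge0M// -normrM mulfV// normr1.
by rewrite (_ : re_part 1 = 1) ?mul1r// /re_part; case: (k).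
Qed.

Let bfun_norm (f : bfun T Y) : K := of_real (sup_norm f).

Let bfun_normD f g : bfun_norm (f + g) <= bfun_norm f + bfun_norm g.
Proof. by rewrite /bfun_norm -of_realD of_real_le// sup_normD. Qed.

Let bfun_normZ (a : K) f : bfun_norm (a *: f) = `|a| * bfun_norm f.
Proof. by rewrite /bfun_norm sup_normZ of_realM reK. Qed.

Let bfun_norm0_eq0 f : bfun_norm f = 0 -> f = 0.
Proof.
move=> /of_real_eq0 f0; apply/val_inj/funext => t /=.
apply/normr0_eq0; rewrite -[LHS]reK//; have := sup_norm_ub f t.
rewrite f0 => ft; have -> : re_part `|f t| = 0.
  by apply/eqP; rewrite eq_le ft rnorm_ge0.
by rewrite -[in LHS](@re0 R k) reK.
Qed.

(* The library wants a K-valued norm, hence the embedding of the real supremum.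
   For empty T the space is trivial and sup set0 = 0. *)
HB.instance Definition _ := Lmodule_isNormed.Build K (bfun T Y)
  bfun_normD bfun_normZ bfun_norm0_eq0.

Lemma bfun_normE (f : bfun T Y) : `|f| = of_real (sup_norm f).
Proof. by []. Qed.

End Theory.
End BoundedFunctions.

Section Operators.
Context {R : realType} {k : scalars}.
Local Notation K := (scalar_field R k).

Record bounded_operator (V W : normedModType K) := BoundedOperator {
  operator :> {linear V -> W};
  operator_bounded : exists M : K, forall v, `|operator v| <= M * `|v| }.

Definition dual_space (V : normedModType K) := bounded_operator V K^o.

(* Stated for bare functions so that it also applies to differences of
   functionals; the unit ball, unlike the unit sphere, is never empty. *)
Definition op_norm {V W : normedModType K} (f : V -> W) : R :=
  sup [set rnorm (f v) | v in [set v | `|v| <= 1]].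

(* The set D(V, u), used for u of norm 1. *)
Definition states (V : normedModType K) (u : V) : set (dual_space V) :=
  [set phi : dual_space V | op_norm phi = 1 /\ phi u = 1].

(* The weights {i01 K} in convex_set are the scalars t with 0 <= t <= 1, which
   for the partial order of R[i] are the real numbers of [0, 1]. *)
Definition closed_convex_hull (A : set K^o) : set K^o :=
  closure (smallest (@convex_set K K^o) A).

End Operators.

Section Subspaces.
Context {R : realType} {k : scalars}.
Local Notation K := (scalar_field R k).

Record closed_subspace (Y : normedModType K) := ClosedSubspace {
  in_subspace : {pred Y};
  subspace_submod : GRing.submod_closed in_subspace;
  subspace_closed : closed [set y | y \in in_subspace] }.

Section Theory.
Context {Y : normedModType K} (X : closed_subspace Y).

HB.instance Definition _ :=
  GRing.isSubmodClosed.Build K Y (in_subspace X) (subspace_submod X).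

Record subspace_type := SubspaceElt {
  subspace_val : Y;
  subspace_valP : subspace_val \in in_subspace X }.

HB.instance Definition _ := [isSub for subspace_val].
HB.instance Definition _ := [Choice of subspace_type by <:].
HB.instance Definition _ := [SubChoice_isSubLmodule of subspace_type by <:].

Let subspace_norm (x : subspace_type) : K := `|\val x|.

Let subspace_normD x y :
  subspace_norm (x + y) <= subspace_norm x + subspace_norm y.
Proof. exact: ler_normD. Qed.

Let subspace_normZ (a : K) x : subspace_norm (a *: x) = `|a| * subspace_norm x.
Proof. exact: normrZ. Qed.

Let subspace_norm0_eq0 x : subspace_norm x = 0 -> x = 0.
Proof. by move=> /normr0_eq0 x0; exact: val_inj. Qed.

HB.instance Definition _ := Lmodule_isNormed.Build K subspace_type
  subspace_normD subspace_normZ subspace_norm0_eq0.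

Lemma subspace_normE (x : subspace_type) : `|x| = `|\val x|.
Proof. by []. Qed.

End Theory.
End Subspaces.

Coercion subspace_type : closed_subspace >-> Sortclass.

Section NumericalRanges.
Context {R : realType} {k : scalars} {Y : normedModType (scalar_field R k)}.
Local Notation K := (scalar_field R k).

Definition unit_sphere (V : normedModType K) := {v : V | `|v| == 1}.

Lemma sphere_restriction_bounded (X : closed_subspace Y)
    (T : bounded_operator X Y) :
  (fun x : unit_sphere X => T (\val x)) \in @bounded_fun_pred R k _ Y.
Proof.
apply/bounded_funE; have [M TM] := operator_bounded T.
by exists M => x; rewrite (le_trans (TM _))// (eqP (valP x)) mulr1.
Qed.

Definition sphere_restriction (X : closed_subspace Y)
    (T : bounded_operator X Y) :
  bfun (unit_sphere X) Y := BFun (sphere_restriction_bounded T).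

Lemma inclusion_bounded (X : closed_subspace Y) :
  exists M : K, forall x : X, `|\val x| <= M * `|x|.
Proof. by exists 1 => x; rewrite mul1r. Qed.

Definition inclusion (X : closed_subspace Y) : bounded_operator X Y :=
  @BoundedOperator R k X Y (\val : {linear X -> Y}) (inclusion_bounded X).

(* Pi(X, Y) *)
Definition supporting_pairs (X : closed_subspace Y) :
    set (unit_sphere X * dual_space Y) :=
  [set p | states (inclusion X (\val p.1)) p.2].
Arguments supporting_pairs : clear implicits.

Definition spatial_range (X : closed_subspace Y) (f : bfun (unit_sphere X) Y) :
    set K^o :=
  [set p.2 (f p.1) | p in supporting_pairs X].

Definition intrinsic_range (X : closed_subspace Y)
    (f : bfun (unit_sphere X) Y) : set K^o :=
  [set Phi f | Phi in states (sphere_restriction (inclusion X))].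

Definition BPB_pair (X : closed_subspace Y) :=
  forall eps : R, 0 < eps -> exists2 delta : R, 0 < delta &
  forall (x0 : unit_sphere X) (y0 : dual_space Y), op_norm y0 = 1 ->
    1 - delta < re_part (y0 (inclusion X (\val x0))) ->
  exists2 p : unit_sphere X * dual_space Y, supporting_pairs X p &
    rnorm (\val x0 - \val p.1) < eps /\ op_norm (y0 \- p.2) < eps.

End NumericalRanges.

Definition FR_property (R : realType) (k : scalars)
    (Y : normedModType (scalar_field R k)) :=
  forall (X : closed_subspace Y) (T : bounded_operator X Y),
    closed_convex_hull (spatial_range (sphere_restriction T)) =
    intrinsic_range (sphere_restriction T).

Definition BPB_property (R : realType) (k : scalars)
    (Y : normedModType (scalar_field R k)) :=
  forall X : closed_subspace Y, BPB_pair X.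

(* Main.v *)
Require Import Defs.
From HB Require Import structures.
From mathcomp Require Import all_boot all_order all_algebra complex.
From mathcomp Require Import all_classical all_reals all_analysis.
From mathcomp Require Import ring lra.

Set Implicit Arguments.
Unset Strict Implicit.
Unset Printing Implicit Defensive.

Import Order.TTheory GRing.Theory Num.Theory.
Import numFieldNormedType.Exports.

Local Open Scope classical_set_scope.
Local Open Scope ring_scope.

(** Fix a closed subspace X of Y with inclusion J, and an operator T from X to
    Y.  The intrinsic range is governed by norms: a scalar lam lies in V(T) if
    and only if |a + b lam| <= ||a J + b T|| for all scalars a and b, since this
    is what the Hahn-Banach theorem needs to extend the functional sending J to
    1 and T to lam ([state_valuesP], [intrinsic_rangeP]).  From this description
    V(T) is visibly convex and closed, and evaluations at pairs of Pi(X, Y) are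
    states, so the closed convex hull of W(T) is contained in V(T).

    For the other inclusion, suppose that lam in V(T) is outside that hull.  A
    scalar c and a gap eta > 0 separate them: Re (c mu) + eta <= Re (c lam) for
    every mu in W(T) ([separation]).  This contradicts [BPB_support], which
    produces mu in W(T) with Re (c mu) as close to Re (c lam) as desired.  For
    small t > 0 one has ||J + t c T|| >= 1 + t Re (c lam), so there is x0 in the
    sphere with ||x0 + t c T x0|| > 1 + t Re (c lam) - t^2.  Let y0 be a
    norm-one functional that norms this vector.  Then Re y0(x0) is close to 1
    for t small, while Re y0(c T x0) > Re (c lam) - t because Re y0(x0) <= 1.
    The Bishop-Phelps-Bollobas hypothesis moves (x0, y0) a little to a pair
    (x, y) of Pi(X, Y), and mu = y(T x) is the required element of W(T).

    The Hahn-Banach theorem is obtained for real-linear functionals by applying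
    Zorn's lemma to their graphs ([hahn_banach_real]); a scalar-linear
    functional is then recovered from its real part
    ([dual_of_real_functional]). *)

(** * Real parts, norms and phases of scalars *)

Section ScalarCalculus.
Context {R : realType} {k : scalars}.
Local Notation K := (scalar_field R k).

Lemma re_of_real (r : R) : re_part (of_real r : K) = r.
Proof. by rewrite /re_part /of_real; case: k. Qed.

Lemma of_real0 : of_real 0 = 0 :> K.
Proof. by rewrite /of_real; case: k. Qed.

Lemma of_real_ge0 (r : R) : 0 <= r -> 0 <= of_real r :> K.
Proof. by move=> /(@of_real_le R k); rewrite of_real0. Qed.

Lemma of_real1 : of_real 1 = 1 :> K.
Proof. by rewrite /of_real; case: k. Qed.

Lemma of_realN (r : R) : of_real (- r) = - of_real r :> K.
Proof. by apply/eqP; rewrite -addr_eq0 -of_realD addNr of_real0. Qed.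

Lemma of_realB (r s : R) : of_real (r - s) = of_real r - of_real s :> K.
Proof. by rewrite of_realD of_realN. Qed.

Lemma ltr_of_real (r s : R) : (of_real r < of_real s :> K) = (r < s).
Proof.
apply/idP/idP => rs.
  rewrite lt_neqAle -[leLHS]re_of_real -[leRHS]re_of_real.
  by rewrite re_le ?ltW// andbT; apply/eqP => rsE; rewrite rsE ltxx in rs.
rewrite lt_neqAle of_real_le ?ltW// andbT.
apply/eqP => /(congr1 (@re_part R k)); rewrite !re_of_real => rsE.
by rewrite rsE ltxx in rs.
Qed.

Lemma norm_of_real (r : R) : `|of_real r : K| = of_real `|r|.
Proof.
have H (s : R) : 0 <= s -> `|of_real s : K| = of_real s.
  by move=> s0; rewrite ger0_norm// of_real_ge0.
have [r0|r0] := leP 0 r; first by rewrite H// (ger0_norm r0).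
by rewrite (ltr0_norm r0) -[r in LHS]opprK of_realN normrN H// oppr_ge0 ltW.
Qed.

Lemma re_of_realM (r : R) (z : K) : re_part (of_real r * z) = r * re_part z.
Proof.
rewrite /re_part /of_real; case: k z => //= -[a b].
by rewrite [LHS]/= (mul0r b) subr0.
Qed.

Lemma reN (z : K) : re_part (- z) = - re_part z.
Proof. by apply/eqP; rewrite -addr_eq0 -reD addNr re0. Qed.

Lemma re_le_norm (z : K) : re_part z <= re_part `|z|.
Proof.
rewrite /re_part; case: k z => [z|[a b]] /=; first exact: ler_norm.
rewrite (le_trans (ler_norm _))// -sqrtr_sqr ler_sqrt ?addr_ge0 ?sqr_ge0//.
by rewrite lerDl sqr_ge0.
Qed.

(** The scalars form a Euclidean space of real dimension one or two; [c] is the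
    conjugate of [x], so that [re_part (c * y)] is the inner product of [x] and
    [y].  This expansion is all that nearest-point arguments need. *)
Lemma real_inner_product (x : K) : exists c : K, forall (y : K) (s : R),
  rnorm (x - of_real s * y : K^o) ^+ 2
    = rnorm (x : K^o) ^+ 2 - 2 * s * re_part (c * y)
      + s ^+ 2 * rnorm (y : K^o) ^+ 2.
Proof.
rewrite /rnorm /re_part /of_real; case: k x => [x|[a b]].
  by exists x => y s /=; rewrite !real_normK ?num_real//; ring.
exists (a -i* b)%C => -[c d] s /=.
rewrite !sqr_sqrtr ?addr_ge0 ?sqr_ge0//; ring.
Qed.

(** Turning a scalar by a unit factor makes its real part equal to its modulus;
    bounds on real parts thus become bounds on norms. *)
Lemma phase (z : K) : exists2 c : K, `|c| = 1 & c * z = `|z|.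
Proof.
have [->|z0] := eqVneq z 0; first by exists 1; rewrite ?normr1// mulr0 normr0.
exists (`|z| / z); last by rewrite divfK.
by rewrite normrM normfV normr_id divff// normr_eq0.
Qed.

Lemma re_mul_inj (z w : K) :
  (forall a : K, re_part (a * z) = re_part (a * w)) -> z = w.
Proof.
move=> zw; have [c _ cz] := phase (z - w).
have : re_part `|z - w| = 0.
  by rewrite -cz mulrBr reD reN zw subrr.
move/(congr1 (@of_real R k)); rewrite reK// => /eqP.
by rewrite of_real0 normr_eq0 subr_eq0 => /eqP.
Qed.

Lemma rnormE (V : normedModType K) (v : V) : of_real (rnorm v) = `|v|.
Proof. exact: reK. Qed.

Section Norms.
Context {V : normedModType K}.
Implicit Types v w : V.

Lemma ler_rnorm (W : normedModType K) v (w : W) :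
  (rnorm v <= rnorm w) = (`|v| <= `|w|).
Proof.
apply/idP/idP => [/(@of_real_le R k)|]; first by rewrite !rnormE.
exact: re_le.
Qed.

Lemma rnorm1 v : (`|v| = 1) <-> (rnorm v = 1).
Proof.
split=> [|vE]; first by rewrite /rnorm => ->; rewrite -of_real1 re_of_real.
by rewrite -rnormE vE of_real1.
Qed.

Lemma rnormD v w : rnorm (v + w) <= rnorm v + rnorm w.
Proof. by rewrite /rnorm -reD; apply/re_le/ler_normD. Qed.

Lemma rnormN v : rnorm (- v) = rnorm v.
Proof. by rewrite /rnorm normrN. Qed.

Lemma rnorm_eq0 v : rnorm v = 0 -> v = 0.
Proof.
move=> v0; by apply/normr0_eq0; rewrite -rnormE v0 of_real0.
Qed.

Lemma rnormZr (r : R) v : rnorm (of_real r *: v) = `|r| * rnorm v.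
Proof. by rewrite rnormZ norm_of_real re_of_real. Qed.

End Norms.
End ScalarCalculus.

(** * The Hahn-Banach theorem over the reals *)

Section HahnBanach.
Context {R : realType} {k : scalars} {V : normedModType (scalar_field R k)}.
Local Notation K := (scalar_field R k).
Implicit Types (G : set (V * R)) (v w : V) (r s t : R).

(** Partially defined functionals are handled through their graphs, so that the
    union of a chain needs no gluing.  A dominated real subspace is
    automatically the graph of a function: if (0, r) belongs to it then so does
    (0, - r), and both r and - r are at most 0. *)
Definition real_subspace G := forall v w r s t,
  G (v, r) -> G (w, s) -> G (v + of_real t *: w, r + t * s).

Definition real_linear (rho : V -> R) := forall v w t,
  rho (v + of_real t *: w) = rho v + t * rho w.

Definition dominated G := forall v r, G (v, r) -> r <= rnorm v.

Definition one_step G v c : set (V * R) :=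
  [set p | exists w s t, G (w, s) /\ p = (w + of_real t *: v, s + t * c)].

(** The value [c] given to the new vector [v] must lie above every
    [s - rnorm (w - v)] and below every [rnorm (w' + v) - s'].  The former never
    exceed the latter, by the triangle inequality applied to w + w'. *)
Lemma one_step_bound G v : real_subspace G -> dominated G -> G (0, 0) ->
  exists c, forall w s, G (w, s) ->
    s + c <= rnorm (w + v) /\ s - c <= rnorm (w - v).
Proof.
move=> Gs Gd G0; pose S := [set p.2 - rnorm (p.1 - v) | p in G].
have ubS w s : G (w, s) -> ubound S (rnorm (w + v) - s).
  move=> Gw _ [[w' s'] Gw' <-] /=.
  have /Gd := Gs _ _ _ _ 1 Gw Gw'.
  rewrite of_real1 scale1r mul1r => sw.
  rewrite lerBlDr addrAC lerBrDl (le_trans sw)//.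
  by rewrite (le_trans _ (rnormD _ _))// addrACA subrr addr0.
exists (sup S) => w s Gw; split.
  rewrite -lerBrDl ge_sup//; last exact: ubS.
  by exists (0 - rnorm (0 - v)); exists (0, 0).
rewrite lerBlDr -lerBlDl; apply: ub_le_sup; last by exists (w, s).
by exists (rnorm (0 + v) - 0); exact: ubS.
Qed.

(** Homogeneity reduces domination at w + t v, for t nonzero, to the two
    cases t = 1 and t = -1, which are the two bounds on [c]. *)
Lemma one_step_dominated G v c : real_subspace G -> dominated G -> G (0, 0) ->
  (forall w s, G (w, s) -> s + c <= rnorm (w + v) /\ s - c <= rnorm (w - v)) ->
  dominated (one_step G v c).
Proof.
move=> Gs Gd G0 cP _ _ [w [s [t [Gw [-> ->]]]]].
have [t0|] := eqVneq `|t| 0.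
  move/eqP: t0; rewrite normr_eq0 => /eqP ->.
  by rewrite of_real0 scale0r mul0r !addr0; exact: Gd.
rewrite normr_eq0 => t0.
have Gt : G (of_real `|t|^-1 *: w, `|t|^-1 * s).
  by have := Gs _ _ _ _ `|t|^-1 G0 Gw; rewrite !add0r.
have nt0 : 0 < `|t| by rewrite normr_gt0.
have wE : w = of_real `|t| *: (of_real `|t|^-1 *: w).
  by rewrite scalerA -of_realM divff ?gt_eqF// of_real1 scale1r.
have [H1 H2] := cP _ _ Gt.
have [tp|tn] := leP 0 t.
  rewrite wE -[X in of_real X *: v](ger0_norm tp) -scalerDr rnormZr normr_id.
  rewrite -ler_pdivrMl// mulrDr mulrA -[X in _ * X * c](ger0_norm tp).
  by rewrite mulVf ?gt_eqF// mul1r.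
have tE : t = - `|t| by rewrite (ltr0_norm tn) opprK.
have vE : of_real t *: v = of_real `|t| *: (- v).
  by rewrite scalerN -scaleNr [in LHS]tE of_realN.
rewrite wE vE -scalerDr rnormZr normr_id.
rewrite -ler_pdivrMl// mulrDr mulrA [X in _ * X * c]tE mulrN mulVf ?gt_eqF//.
by rewrite mulN1r.
Qed.

Lemma one_step_subspace G v c :
  real_subspace G -> real_subspace (one_step G v c).
Proof.
move=> Gs _ _ _ _ t [w [s [a [Gw [-> ->]]]]] [w' [s' [b [Gw' [-> ->]]]]].
exists (w + of_real t *: w'), (s + t * s'), (a + t * b).
split; first exact: Gs.
congr pair; last by ring.
by rewrite of_realD of_realM scalerDl scalerDr scalerA addrACA.
Qed.

(** A maximal dominated subspace of V * R containing [G] projects onto V, for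
    otherwise a one-step extension would be larger. *)
Lemma hahn_banach_real G : real_subspace G -> dominated G -> G (0, 0) ->
  exists rho : V -> R, [/\ real_linear rho, forall v, rho v <= rnorm v &
    forall v r, G (v, r) -> rho v = r].
Proof.
move=> Gs Gd G0.
(* The empty chain has an empty union, so the empty graph has to be allowed; a
   maximal element is nonempty because it cannot lie strictly below [G]. *)
pose P (A : set (V * R)) :=
  [/\ real_subspace A, dominated A & A !=set0 -> G `<=` A].
have [A [[As Ad GA] Amax]] : exists A, P A /\ forall B, A `<` B -> ~ P B.
  apply: Zorn_bigcup => F FP Ftot; split.
  - move=> v w r s t [A FA Av] [B FB Bw].
    have [AB|BA] := Ftot _ _ FA FB.
      exists B => //; have [Bs _ _] := FP _ FB; apply: Bs => //; exact: AB.
    exists A => //; have [As _ _] := FP _ FA; apply: As => //; exact: BA.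
  - by move=> v r [A FA Av]; have [_ Ad _] := FP _ FA; exact: Ad.
  - move=> [p [A FA Ap]] q Gq; exists A => //.
    by have [_ _ GA] := FP _ FA; apply: GA => //; exists p.
have {}GA : G `<=` A.
  apply: GA; apply/set0P/eqP => A0; apply: (Amax G); last by split=> // _ ? ?.
  by rewrite A0; split=> [|H]; [exact: sub0set | exact: H G0].
have A0 := GA _ G0.
have Atot v : exists r, A (v, r).
  have [c cP] := one_step_bound v As Ad A0.
  have sub : A `<=` one_step A v c.
    move=> [w s] Aw; exists w, s, 0.
    by rewrite of_real0 scale0r mul0r !addr0.
  have Av : one_step A v c (v, c).
    by exists 0, 0, 1; rewrite of_real1 scale1r mul1r !add0r.
  have [[r Ar]|nA] := pselect (exists r, A (v, r)); first by exists r.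
  exfalso; apply: (Amax (one_step A v c)); last split.
  - by split=> // H; apply: nA; exists c; exact: H Av.
  - exact: one_step_subspace.
  - exact: one_step_dominated.
  - by move=> _; exact: subset_trans sub.
have Afun v r s : A (v, r) -> A (v, s) -> r = s.
  have le r' s' : A (v, r') -> A (v, s') -> r' <= s'.
    move=> Ar As'; have /Ad := As _ _ _ _ (-1) Ar As'.
    rewrite (_ : v + _ = 0) ?/rnorm ?normr0 ?re0 ?mulN1r ?subr_le0//.
    by rewrite of_realN of_real1 scaleN1r subrr.
  by move=> Ar As'; apply/eqP; rewrite eq_le !le.
pose rho v := sval (cid (Atot v)).
have rhoP v : A (v, rho v) := svalP (cid (Atot v)).
exists rho; split=> [v w t|v|v r Gv].
- exact: Afun (rhoP _) (As _ _ _ _ _ (rhoP _) (rhoP _)).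
- exact: Ad (rhoP v).
- exact: Afun (rhoP v) (GA _ Gv).
Qed.

End HahnBanach.

(** * Dual functionals and states *)

Section Functionals.
Context {R : realType} {k : scalars}.
Local Notation K := (scalar_field R k).

(** Over the complex numbers the functional with real part rho is
    rho v - i rho (i v). *)
Lemma complexify (V : normedModType K) (rho : V -> R) :
  real_linear rho ->
  exists2 phi : V -> K, forall a v w, phi (a *: v + w) = a * phi v + phi w &
    forall v, re_part (phi v) = rho v.
Proof.
rewrite /real_linear /of_real /re_part; case: k V rho => V rho rhoL.
  by exists rho => // a v w; rewrite addrC [LHS]rhoL addrC.
pose i : R[i] := 'i%C.
exists (fun v => rho v -i* rho (i *: v))%C => // -[x y] v w.
have aE (u : V) :
    ((x +i* y)%C : R[i]) *: u = (x%:C)%C *: u + (y%:C)%C *: (i *: u).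
  rewrite scalerA -scalerDl; congr (_ *: _).
  by apply/eqP; rewrite eq_complex /=; apply/andP; split; apply/eqP; ring.
have rhoN u : rho (- u) = - rho u.
  have := rhoL u u (-1); rewrite [X in X *: u](_ : _ = -1); last first.
    by apply/eqP; rewrite eq_complex /= oppr0 !eqxx.
  rewrite scaleN1r subrr => rho0.
  have := rhoL 0 u (-1); rewrite [X in X *: u](_ : _ = -1); last first.
    by apply/eqP; rewrite eq_complex /= oppr0 !eqxx.
  by rewrite scaleN1r add0r mulN1r rho0 mulN1r subrr add0r.
have iiE (u : V) : i *: (i *: u) = - u.
  rewrite scalerA -scaleN1r; congr (_ *: _).
  by apply/eqP; rewrite eq_complex /=; apply/andP; split; apply/eqP; ring.
have re1 : rho ((x +i* y)%C *: v + w) = rho w + x * rho v + y * rho (i *: v).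
  by rewrite aE addrC addrA !rhoL.
have im1 : rho (i *: ((x +i* y)%C *: v + w)) =
    rho (i *: w) + x * rho (i *: v) - y * rho v.
  rewrite scalerDr scalerA mulrC -scalerA aE iiE addrC addrA !rhoL rhoN.
  by rewrite mulrN.
rewrite re1 im1; apply/eqP; rewrite eq_complex /=.
by apply/andP; split; apply/eqP; ring.
Qed.

(** Passing from rho to a scalar-linear functional does not increase the norm:
    after turning v by a phase, |Phi v| is the real part of Phi (c v). *)
Lemma dual_of_real_functional (V : normedModType K) (rho : V -> R) :
  real_linear rho -> (forall v, rho v <= rnorm v) ->
  exists2 Phi : dual_space V, forall v, re_part (Phi v) = rho v &
    forall v, rnorm (Phi v) <= rnorm v.
Proof.
move=> rhoL rhod; have [phi phiL phiE] := complexify rhoL.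
pose lphi : {linear V -> K^o} :=
  HB.pack phi (GRing.isLinear.Build K V K^o _ phi phiL).
have phi_le v : rnorm (lphi v) <= rnorm v.
  have [c c1 cE] := phase (lphi v).
  rewrite [leLHS](_ : _ = rho (c *: v)); last first.
    rewrite -phiE -[phi _]/(lphi _) linearZ /rnorm -cE//.
  by rewrite (le_trans (rhod _))// rnormZ c1 -of_real1 re_of_real mul1r.
have bd : exists M : K, forall v, `|lphi v| <= M * `|v|.
  by exists 1 => v; rewrite mul1r -ler_rnorm.
by exists (BoundedOperator bd).
Qed.

Section OperatorNorm.
Context {V W : normedModType K}.

Definition bounded_map (g : V -> W) :=
  exists M : K, forall v, `|g v| <= M * `|v|.

(** The supremum defining [op_norm] is junk on unbounded sets, hence the
    boundedness hypothesis. *)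
Lemma op_norm_unit (g : V -> W) v : bounded_map g ->
  `|v| <= 1 -> rnorm (g v) <= op_norm g.
Proof.
move=> [M gM] v1; apply: ub_le_sup; last by exists v.
exists (re_part `|M|) => _ [w w1 <-]; apply: re_le.
rewrite (le_trans (gM w))//.
have M0 : 0 <= M * `|w| by rewrite (le_trans _ (gM w)).
by rewrite -(ger0_norm M0) normrM normr_id ler_piMr.
Qed.

Lemma op_norm_ge0 (g : V -> W) : bounded_map g -> 0 <= op_norm g.
Proof.
move=> gM; apply: le_trans (rnorm_ge0 (g 0)) (op_norm_unit gM _).
by rewrite normr0.
Qed.

Lemma op_norm_bound (g : {linear V -> W}) v :
  bounded_map g -> rnorm (g v) <= op_norm g * rnorm v.
Proof.
move=> gM; have [/rnorm_eq0 ->|v0] := eqVneq (rnorm v) 0.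
  by rewrite linear0 /rnorm !normr0 re0 mulr0.
have vp : 0 < rnorm v by rewrite lt_neqAle eq_sym v0 rnorm_ge0.
rewrite -ler_pdivrMr// mulrC -[X in X * _]ger0_norm ?invr_ge0 ?(ltW vp)//.
rewrite -rnormZr -linearZ op_norm_unit//.
rewrite -rnormE rnormZr ger0_norm ?invr_ge0 ?(ltW vp)// mulVf//.
by rewrite of_real1.
Qed.

Lemma op_norm_le (g : V -> W) (M : R) : 0 <= M ->
  (forall v, rnorm (g v) <= M * rnorm v) -> op_norm g <= M.
Proof.
move=> M0 gM; apply: ge_sup.
  by exists (rnorm (g 0)); exists 0 => //=; rewrite normr0.
move=> _ [v v1 <-]; rewrite (le_trans (gM v))// ler_piMr//.
by rewrite -[leRHS](@re_of_real R k) of_real1 re_le.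
Qed.

End OperatorNorm.

(** The values at [f] of the states at [u] are cut out by norm inequalities.
    Necessity is clear.  Conversely, the inequalities with real parts make
    a u + b f |-> Re (a + b lam) a dominated functional on the span of u and f,
    well defined even when u and f are dependent, and any extension of it is the
    real part of a state.  Weak-star compactness of the set of states is thereby
    avoided. *)
Lemma state_valuesP (V : normedModType K) (u f : V) (lam : K) : rnorm u <= 1 ->
  (exists2 Phi : dual_space V, states u Phi & Phi f = lam) <->
  (forall a b : K, rnorm (a + b * lam : K^o) <= rnorm (a *: u + b *: f)).
Proof.
move=> u1; split=> [[Phi [Phi1 Phiu] <-] a b|H].
  have := op_norm_bound (a *: u + b *: f) (operator_bounded Phi).
  by rewrite Phi1 mul1r linearD !linearZ/= Phiu [_ *: 1]mulr1.
pose G : set (V * R) :=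
  [set p | exists a b : K, p = (a *: u + b *: f, re_part (a + b * lam))].
have Gs : real_subspace G.
  move=> _ _ _ _ t [a [b [-> ->]]] [a' [b' [-> ->]]].
  exists (a + of_real t * a'), (b + of_real t * b'); congr pair.
    by rewrite !scalerDl scalerDr !scalerA addrACA.
  by rewrite -re_of_realM -reD; congr re_part; ring.
have Gd : dominated G.
  by move=> _ _ [a [b [-> ->]]]; rewrite (le_trans (re_le_norm _))//; exact: H.
have G0 : G (0, 0).
  by exists 0, 0; rewrite !scale0r mul0r !addr0 re0.
have [rho [rhoL rhod rhoG]] := hahn_banach_real Gs Gd G0.
have [Phi PhiE Phid] := dual_of_real_functional rhoL rhod.
have PhiG a b : re_part (Phi (a *: u + b *: f)) = re_part (a + b * lam).
  by rewrite PhiE; apply: rhoG; exists a, b.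
have Phiu : Phi u = 1.
  apply: re_mul_inj => a; rewrite -[a * _]/(a *: Phi u : K^o) -linearZ/=.
  by have := PhiG a 0; rewrite scale0r !mul0r !addr0 mulr1.
exists Phi; last first.
  apply: re_mul_inj => b; rewrite -[b * _]/(b *: Phi f : K^o) -linearZ/=.
  by have := PhiG 0 b; rewrite scale0r !add0r.
split=> //; apply/eqP; rewrite eq_le op_norm_le//=; last first.
  by move=> v; rewrite mul1r.
rewrite (le_trans _ (op_norm_unit (operator_bounded Phi) (v := u) _))//.
  by rewrite Phiu /rnorm normr1 -of_real1 re_of_real.
by rewrite -rnormE -of_real1 of_real_le.
Qed.

(** A unit vector u has a state: this is [state_valuesP] with [f] and [lam]
    equal to 0. *)
Lemma norming_functional (V : normedModType K) (v : V) : 0 < rnorm v ->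
  exists2 phi : dual_space V, op_norm phi = 1 & phi v = of_real (rnorm v).
Proof.
move=> v0; pose u := of_real (rnorm v)^-1 *: v.
have u1 : rnorm u = 1.
  by rewrite rnormZr ger0_norm ?invr_ge0 ?(ltW v0)// mulVf ?gt_eqF.
have u_le1 : rnorm u <= 1 by rewrite u1.
have [|phi [phi1 phiu] _] := (state_valuesP 0 0 u_le1).2.
  move=> a b; rewrite mulr0 scaler0 !addr0 rnormZ u1 mulr1//.
exists phi => //.
have -> : v = of_real (rnorm v) *: u.
  by rewrite scalerA -of_realM divff ?gt_eqF// of_real1 scale1r.
by rewrite linearZ/= phiu [_ *: _]mulr1 rnormZr u1 mulr1 ger0_norm// ltW.
Qed.

End Functionals.

(** * Convex sets of scalars *)

Section PlaneConvexity.
Context {R : realType} {k : scalars}.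
Local Notation K := (scalar_field R k).
Implicit Types (C : set K^o) (lam mu : K^o).

(** Balls are indexed by positive scalars, which over the complex numbers are
    the positive real numbers. *)
Lemma closureP (V : normedModType K) (A : set V) (v : V) :
  closure A v <-> forall e : R, 0 < e -> exists2 w, A w & rnorm (v - w) < e.
Proof.
split=> [Av e e0|H B /nbhs_ballP[e /= e0 eB]].
  have ep : 0 < of_real e :> K by rewrite -of_real0 ltr_of_real.
  have [w [Aw]] := Av _ (nbhsx_ballx v _ ep).
  by rewrite -ball_normE /= -rnormE ltr_of_real; exists w.
have e0' : 0 < re_part e by rewrite -(@ltr_of_real R k) of_real0 reK// ltW.
have [w Aw vw] := H _ e0'; exists w; split=> //; apply: eB.
by rewrite -ball_normE /= -rnormE -(reK (ltW e0)) ltr_of_real.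
Qed.

Lemma convex_setP C : convex_set C <->
  forall mu nu (t : R), 0 <= t -> t <= 1 -> C mu -> C nu ->
    C (of_real t * mu + of_real (1 - t) * nu).
Proof.
split=> [cC mu nu t t0 t1 Cmu Cnu|H mu nu l].
  have tK1 : of_real t <= 1 :> K by rewrite -of_real1 of_real_le.
  have := cC mu nu (Itv01 (of_real_ge0 t0) tK1); rewrite !inE => /(_ Cmu Cnu).
  have -> // : of_real (1 - t) = 1 - of_real t :> K.
  by rewrite of_realB of_real1.
rewrite !inE => Cmu Cnu.
have l0 : 0 <= l%:num by [].
have l1 : l%:num <= 1 by [].
have p0 : 0 <= re_part l%:num by rewrite -(@re0 R k) re_le.
have p1 : re_part l%:num <= 1.
  by rewrite -[leRHS](@re_of_real R k) of_real1 re_le.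
have := H mu nu _ p0 p1 Cmu Cnu; rewrite reK//.
have -> // : of_real (1 - re_part l%:num) = 1 - l%:num :> K.
by rewrite of_realB of_real1 reK.
Qed.

(** The functional is the inner product with lam - mu0, where mu0 in [C] is
    almost nearest to [lam].  Comparing mu0 with the points mu0 + s (mu - mu0)
    of [C] for a small s shows that the inner product with mu - mu0 is at most
    e^2 / 2, where e bounds the distance from [lam] to [C] from below;
    boundedness of [C] makes one s work for all mu. *)
Lemma separation C lam (D : R) : convex_set C ->
  (forall mu, C mu -> rnorm mu <= D) -> ~ closure C lam ->
  exists c : K, exists2 eta : R, 0 < eta &
    forall mu, C mu -> re_part (c * mu) + eta <= re_part (c * lam).
Proof.
move=> /convex_setP cC CD nC.
have [[mu1 Cmu1]|C0] := pselect (C !=set0); last first.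
  by exists 0, 1 => // mu Cmu; exfalso; apply: C0; exists mu.
have [e e0 eP] : exists2 e : R,
    0 < e & forall mu, C mu -> e <= rnorm (lam - mu).
  apply: contrapT => H; apply: nC; apply/closureP => e e0.
  apply: contrapT => H'; apply: H; exists e => // mu Cmu.
  by rewrite leNgt; apply/negP => lt; apply: H'; exists mu.
pose Q := [set rnorm (lam - mu) ^+ 2 | mu in C].
have lbQ : lbound Q 0 by move=> _ [mu _ <-]; exact: sqr_ge0.
have Q0 : Q !=set0 by exists (rnorm (lam - mu1) ^+ 2), mu1.
pose B := (2 * D) ^+ 2 + 1; have B0 : 0 < B by rewrite ltr_wpDl ?sqr_ge0.
(* [B] bounds the squared norm of every mu - mu0.  With s B <= e^2 / 2 and mu0
   optimal up to s e^2 / 2, each error contributes half of the s e^2 allowed in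
   the comparison. *)
pose s := Num.min 1 (e ^+ 2 / (2 * B)).
have e20 : 0 < e ^+ 2 by rewrite exprn_gt0.
have s0 : 0 < s by rewrite lt_min ltr01 divr_gt0// mulr_gt0.
have s1 : s <= 1 by rewrite ge_min lexx.
have sB : s * B <= e ^+ 2 / 2.
  rewrite -ler_pdivlMr// (le_trans (_ : _ <= e ^+ 2 / (2 * B)))//.
    by rewrite ge_min lexx orbT.
  by rewrite invfM mulrA.
have se0 : 0 < s * (e ^+ 2 / 2) by rewrite mulr_gt0// divr_gt0.
have [_ [mu0 Cmu0 <-] mu0P] := inf_adherent se0 (conj Q0 (ex_intro _ _ lbQ)).
have [c cP] := real_inner_product (lam - mu0).
exists c, (e ^+ 2 / 2) => [|mu Cmu]; first by rewrite divr_gt0.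
have cx : re_part (c * (lam - mu0)) = rnorm (lam - mu0) ^+ 2.
  have := cP (lam - mu0) 1; rewrite of_real1 mul1r subrr /rnorm normr0 re0.
  by rewrite -/(rnorm _); lra.
have ex : e ^+ 2 <= rnorm (lam - mu0) ^+ 2.
  by rewrite lerXn2r ?nnegrE ?rnorm_ge0 ?(ltW e0)// eP.
have infle : inf Q <= rnorm (lam - mu0 - of_real s * (mu - mu0) : K^o) ^+ 2.
  apply: ge_inf; first by exists 0.
  exists (of_real s * mu + of_real (1 - s) * mu0).
    by apply: cC => //; exact: ltW.
  congr (rnorm _ ^+ 2).
  by rewrite of_realB of_real1; ring.
have yB : rnorm (mu - mu0) ^+ 2 <= B.
  rewrite /B (le_trans (_ : _ <= (2 * D) ^+ 2)) ?lerDl//.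
  rewrite lerXn2r ?nnegrE ?rnorm_ge0//.
    by rewrite mulr_ge0// (le_trans (rnorm_ge0 mu)) ?CD.
  by rewrite (le_trans (rnormD _ _))// rnormN mulr2n mulrDl mul1r lerD ?CD.
rewrite cP in infle.
have key : re_part (c * (mu - mu0)) <= e ^+ 2 / 2.
  rewrite -(ler_pM2l s0).
  have : s ^+ 2 * rnorm (mu - mu0) ^+ 2 <= s * (e ^+ 2 / 2).
    rewrite expr2 -mulrA ler_pM2l//; apply: le_trans sB.
    by rewrite ler_pM2l.
  move: infle mu0P; set x2 := rnorm (lam - mu0) ^+ 2.
  set r := re_part _; set y2 := s ^+ 2 * _; lra.
move: key cx; rewrite !mulrBr !reD !reN.
lra.
Qed.

End PlaneConvexity.

(** * Numerical ranges *)

Section NumericalRangeTheory.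
Context {R : realType} {k : scalars} {Y : normedModType (scalar_field R k)}.
Local Notation K := (scalar_field R k).
Variable X : closed_subspace Y.
Local Notation J := (sphere_restriction (inclusion X)).
Implicit Types (f : bfun (unit_sphere X) Y) (T : bounded_operator X Y).
Implicit Types (lam : K^o).

Lemma rnorm_sup f : rnorm f = sup_norm f.
Proof. by rewrite /rnorm bfun_normE re_of_real. Qed.

Lemma rnorm_sphere (x : unit_sphere X) : rnorm (\val x : X) = 1.
Proof. by apply/rnorm1/eqP; exact: valP x. Qed.

Lemma rnorm_val (x : X) : rnorm (\val x : Y) = rnorm x.
Proof. by rewrite /rnorm subspace_normE. Qed.

Lemma intrinsic_rangeP f lam : intrinsic_range f lam <->
  forall a b : K, rnorm (a + b * lam : K^o) <= rnorm (a *: J + b *: f).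
Proof.
apply: state_valuesP; rewrite rnorm_sup; apply: sup_norm_le => // x.
by rewrite [leLHS]rnorm_val rnorm_sphere.
Qed.

Lemma intrinsic_range_bounded f lam :
  intrinsic_range f lam -> rnorm lam <= rnorm f.
Proof.
by move=> /intrinsic_rangeP/(_ 0 1); rewrite scale0r scale1r mul1r !add0r.
Qed.

(** For fixed a and b the inequality of [intrinsic_rangeP] defines a closed
    convex set of lam. *)
Lemma intrinsic_range_convex f : convex_set (intrinsic_range f).
Proof.
apply/convex_setP => mu nu t t0 t1 /intrinsic_rangeP mP /intrinsic_rangeP nP.
apply/intrinsic_rangeP => a b.
have of1 : of_real t + of_real (1 - t) = 1 :> K.
  by rewrite -of_realD addrC subrK of_real1.
rewrite [leLHS](_ : _ = rnorm (of_real t *: (a + b * mu : K^o)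
    + of_real (1 - t) *: (a + b * nu : K^o))); last first.
  congr rnorm; rewrite -[in LHS](mulr1 a) -[in LHS]of1.
  by rewrite /GRing.scale /=; ring.
rewrite (le_trans (rnormD _ _))// !rnormZr !ger0_norm ?subr_ge0//.
have tt : t + (1 - t) = 1 by rewrite addrC subrK.
rewrite -[leRHS]mul1r -[X in _ <= X * _]tt [leRHS]mulrDl.
by rewrite lerD// ler_wpM2l ?subr_ge0.
Qed.

Lemma intrinsic_range_closed f : closed (intrinsic_range f).
Proof.
move=> lam /closureP cl; apply/intrinsic_rangeP => a b.
apply/ler_addgt0Pr => e e0.
have d0 : 0 < e / (rnorm (b : K^o) + 1).
  by rewrite divr_gt0// ltr_wpDl ?rnorm_ge0.
have [mu /intrinsic_rangeP mP lm] := cl _ d0.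
rewrite [leLHS](_ : _ = rnorm ((a + b * mu : K^o) + b *: (lam - mu)));
  last first.
  by congr rnorm; rewrite /GRing.scale /=; ring.
rewrite (le_trans (rnormD _ _))// lerD// rnormZ -/(rnorm (b : K^o)).
rewrite (le_trans (ler_wpM2l (rnorm_ge0 _) (ltW lm)))//.
rewrite mulrCA ger_pMr// ler_pdivrMr ?mul1r ?lerDl//.
by rewrite ltr_wpDl ?rnorm_ge0.
Qed.

Lemma spatial_range_sub f : spatial_range f `<=` intrinsic_range f.
Proof.
move=> _ [[x y] [/= y1 yx] <-]; apply/intrinsic_rangeP => a b.
have := op_norm_bound ((a *: J + b *: f) x) (operator_bounded y).
rewrite y1 mul1r [y _](_ : _ = a + b * y (f x)).
  by move=> /le_trans; apply; rewrite rnorm_sup sup_norm_ub.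
transitivity (y (a *: (\val (\val x) : Y) + b *: f x)) => //.
by rewrite linearD !linearZ/= yx [_ *: 1]mulr1.
Qed.

Lemma closed_hull_sub f :
  closed_convex_hull (spatial_range f) `<=` intrinsic_range f.
Proof.
have /closure_id -> := @intrinsic_range_closed f.
apply: closureS; apply: smallest_sub; first exact: intrinsic_range_convex.
exact: spatial_range_sub.
Qed.

(** Elements of W(T) reach as far as V(T) in every direction [c]: a functional
    that nearly attains the norm of J + t c T nearly attains the norm of J, so
    the Bishop-Phelps-Bollobas condition applies to it. *)
Lemma BPB_support T (c : K) lam (e : R) : BPB_pair X -> 0 < e ->
  intrinsic_range (sphere_restriction T) lam ->
  exists2 mu, spatial_range (sphere_restriction T) mu &
    re_part (c * lam) - e < re_part (c * mu).
Proof.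
move=> bpb e0 /intrinsic_rangeP lamP.
(* [N] is the norm of c T. *)
pose N := re_part `|c| * op_norm T.
have c0 : 0 <= re_part `|c| by rewrite -(@re0 R k) re_le.
have N0 : 0 <= N by rewrite mulr_ge0// op_norm_ge0//; exact: operator_bounded.
have cT (x : X) : rnorm (c *: T x) <= N * rnorm x.
  by rewrite rnormZ -mulrA ler_wpM2l// op_norm_bound//; exact: operator_bounded.
have cTs (x : unit_sphere X) : rnorm (c *: T (\val x)) <= N.
  by rewrite (le_trans (cT _))// rnorm_sphere mulr1.
set L := re_part (c * lam).
have N1 : 0 < N + 1 by rewrite ltr_wpDl.
(* The loss e is shared between t (at most e / 2) and the two displacements of
   size ep, which cost at most 2 ep N. *)
pose ep := e / (4 * (N + 1)).
have ep0 : 0 < ep by rewrite divr_gt0// mulr_gt0.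
have epN : 2 * (ep * N) < e / 2.
  have : ep * (4 * (N + 1)) = e by rewrite divfK// gt_eqF// mulr_gt0.
  nra.
have [d d0 dP] := bpb _ ep0.
have L_ge : - N <= L.
  have := lamP 0 (- c); rewrite scale0r !add0r => H.
  rewrite lerNl /L -reN -mulNr (le_trans (re_le_norm _))//.
  rewrite (le_trans H)// rnorm_sup sup_norm_le// => x.
  by rewrite (le_trans _ (cTs x))// -[leRHS]rnormN -scaleNr.
(* The first bound keeps 1 + t L - t^2 nonnegative; the last makes
   Re y0(x0) > 1 - 2 t N - t^2 exceed 1 - d. *)
pose t := Num.min (1 / (N + 1)) (Num.min (e / 2) (d / (4 * (N + 1)))).
have t0 : 0 < t by rewrite !lt_min !divr_gt0// mulr_gt0.
have te : t <= e / 2 by rewrite !ge_min lexx orbT.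
have t1 : t * (N + 1) <= 1 by rewrite -ler_pdivlMr// ge_min lexx.
have td : t * (4 * (N + 1)) <= d.
  by rewrite -ler_pdivlMr ?mulr_gt0// !ge_min lexx !orbT.
have tN0 : 0 <= t * N by rewrite mulr_ge0// ltW.
have tLN : - (t * N) <= t * L by rewrite -mulrN ler_wpM2l// ltW.
have tt : t * t <= t by rewrite ler_piMr ?(ltW t0)//; lra.
pose pert (x : unit_sphere X) : Y :=
  \val (\val x) + of_real t *: (c *: T (\val x)).
have [x0 x0P] : exists x0, 1 + t * L - t * t < rnorm (pert x0).
  apply: contrapT => H.
  have : rnorm (1 *: J + (of_real t * c) *: sphere_restriction T) <=
      1 + t * L - t * t.
    rewrite rnorm_sup sup_norm_le//; first by lra.
    move=> x; rewrite leNgt; apply/negP => lt; apply: H; exists x.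
    by rewrite /pert scalerA -[X in rnorm (X + _)]scale1r.
  move=> /(le_trans (lamP _ _)) /(le_trans (re_le_norm _)).
  rewrite reD -mulrA re_of_realM -of_real1 re_of_real -/L.
  by rewrite lerDl leNgt oppr_lt0 mulr_gt0.
have [|y0 y01 y0E] := norming_functional (v := pert x0).
  by apply: le_lt_trans x0P; lra.
have y0d := op_norm_bound _ (operator_bounded y0).
rewrite y01 in y0d.
have rey0 (v : Y) : re_part (y0 v) <= rnorm v.
  by rewrite (le_trans (re_le_norm _))// (le_trans (y0d v))// mul1r.
have y0sum : re_part (y0 (\val (\val x0))) + t * re_part (y0 (c *: T (\val x0)))
    = rnorm (pert x0).
  rewrite -[RHS](@re_of_real R k) -y0E /pert linearD reD; congr (_ + _).
  by rewrite [in RHS]linearZ; apply/esym/re_of_realM.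
have y0x0 : re_part (y0 (\val (\val x0))) <= 1.
  by rewrite (le_trans (rey0 _))// rnorm_val rnorm_sphere.
have y0T : re_part (y0 (c *: T (\val x0))) <= N.
  exact: le_trans (rey0 _) (cTs x0).
have ty0T : t * re_part (y0 (c *: T (\val x0))) <= t * N by rewrite ler_pM2l.
have [|[x y] /= [y1 yx] [xx0 yy0]] := dP x0 y0 y01.
  by rewrite [X in re_part X]/(y0 (\val (\val x0))); lra.
exists (y (T (\val x))); first by exists (x, y).
have bdB : exists M : K, forall v, `|(y0 \- y) v| <= M * `|v|.
  have [M0 M0P] := operator_bounded y0; have [M1 M1P] := operator_bounded y.
  exists (M0 + M1) => v; rewrite mulrDl (le_trans (ler_normB _ _))//.
  by rewrite lerD.
have h1 : rnorm ((y0 \- y) (c *: T (\val x0))) <= ep * N.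
  rewrite (le_trans (op_norm_bound _ bdB))//.
  by rewrite ler_pM ?rnorm_ge0 ?op_norm_ge0// ltW.
have h2 : rnorm (y (c *: T (\val x0 - \val x))) <= ep * N.
  rewrite (le_trans (op_norm_bound _ (operator_bounded y)))// y1 mul1r.
  by rewrite (le_trans (cT _))// mulrC ler_wpM2r// ltW.
(* (x0, y0) is moved in two stages: first the functional, then the point. *)
have split : y0 (c *: T (\val x0)) = c * y (T (\val x))
    + ((y0 \- y) (c *: T (\val x0)) + y (c *: T (\val x0 - \val x))).
  rewrite /= linearB scalerBr linearB.
  have -> : y (c *: T (\val x)) = c * y (T (\val x)) by rewrite linearZ.
  by ring.
have := re_le_norm ((y0 \- y) (c *: T (\val x0))).
have := re_le_norm (y (c *: T (\val x0 - \val x))).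
have := congr1 (@re_part R k) split; rewrite !reD => spl r1 r2.
have : t * (L - t) < t * re_part (y0 (c *: T (\val x0))).
  by rewrite mulrBr; lra.
rewrite ltr_pM2l// => r3.
have := le_trans r1 h2; have := le_trans r2 h1.
lra.
Qed.

End NumericalRangeTheory.

Theorem corollary4p4 (R : realType) (k : scalars)
    (Y : completeNormedModType (scalar_field R k)) :
  BPB_property Y -> FR_property Y.
Proof.
move=> bpb X T; apply/seteqP; split; first exact: closed_hull_sub.
move=> lam lamV; apply: contrapT => nhull.
have hullV := @smallest_sub _ _ _ _ (@intrinsic_range_convex _ _ _ _ _)
  (@spatial_range_sub _ _ _ _ (sphere_restriction T)).
have [||c [eta eta0 cP]] :=
  separation (D := rnorm (sphere_restriction T)) _ _ nhull.
- apply/convex_setP => mu nu t t0 t1 Hmu Hnu A AP.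
  have [/convex_setP cA _] := AP.
  by apply: cA => //; [exact: Hmu|exact: Hnu].
- by move=> mu /hullV; exact: intrinsic_range_bounded.
have [mu muW] := BPB_support c (bpb X) eta0 lamV.
have := cP _ (sub_gen_smallest muW).
lra.
Qed.
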